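(* Let $A$, $B$, $C$ be $m \times n$ matrices over $\{-1,0,1\}$ such that $A$ has an entry $0$ and $(A,B,C)$ is neither independent from $B$ nor independent from $C$. Suppose $A$ and $B$ are not layered matrices and $C$ is a layered matrix. Then ${\rm IST}(A,B,C)=\infty$ if and only if $(A,B,C)$ is an all-but-leftmost-negative triple, i.e., every row of $A$ and every row of $B$ is one of the strings $0(-1)^{n-1}$, $1(-1)^{n-1}$, and $C$ is the all-$(-1)$ matrix.
   Context: Rows of matrices are written as strings; $x^r$ denotes the symbol $x$ repeated $r$ times. For an $m\times n$ matrix $M=[m_{ij}]$ over $\{-1,0,1\}$, $G_o(M)$ is the directed graph on $\{1,\dots,n+m\}$ with edges $j\to i$ for all $1\le j<i\le n$, and for $1\le p\le m$, $1\le j\le n$: an edge $j\to n+p$ if $m_{pj}=1$, an edge $n+p\to j$ if $m_{pj}=-1$, no edge if $m_{pj}=0$; no edges among $n+1,\dots,n+m$. A directed graph is semi-transitive if it is acyclic and for every directed path $u_1\to\cdots\to u_t$, $t\ge2$, either there is no edge $u_1\to u_t$ or all edges $u_i\to u_j$ ($1\le i<j\le t$) exist. For $m\times n$ matrices $A,B,C$ over $\{-1,0,1\}$, the morphism $\varphi$ replaces each entry $0,1,-1$ by the block $A,B,C$ respectively; $M^k(A,B,C)=\varphi^k([0])$ and $G_o^k(A,B,C)=G_o(M^k(A,B,C))$. If $A$ has an entry $0$, ${\rm IST}(A,B,C)$ is the least $\ell\ge0$ with $G_o^\ell(A,B,C)$ not semi-transitive, or $\infty$ if none exists. A matrix is layered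 if all entries in each row are identical. $(A,B,C)$ is independent from $B$ if there are no $1$'s in $A$ and $C$; it is independent from $C$ if there are no $(-1)$'s in $A$ and $B$. *)

(* Defs.v *)
From mathcomp Require Import all_boot all_order all_algebra.
From mathcomp Require Import boolp mxtens.

Set Implicit Arguments.
Unset Strict Implicit.
Unset Printing Implicit Defensive.

Import GRing.Theory.
Local Open Scope ring_scope.

Definition ternary_mx (m n : nat) (M : 'M[int]_(m, n)) : Prop :=
  forall i j, M i j \in [:: -1; 0; 1].

(* Directed graphs on a finite type are boolean relations; [e u v] is the edge
   u -> v. *)

Definition acyclic (T : finType) (e : rel T) : Prop :=
  forall c : seq T, ucycle e c -> c = [::].

(* The sequence u :: p is the path u_1 -> ... -> u_t; [pairwise e] holds when
   e u_i u_j for all i < j. Vertices are not required to be distinct, but they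
   are so automatically once the graph is acyclic. *)
Definition semi_transitive (T : finType) (e : rel T) : Prop :=
  acyclic e /\
  forall (u : T) (p : seq T), p != [::] -> path e u p ->
    ~~ e u (last u p) \/ pairwise e (u :: p).

(* The vertices 1, ..., n + m are shifted to 0, ..., n + m - 1: the vertex
   [lshift m j] stands for column j and [rshift n p] for row p. *)
Definition Go (m n : nat) (M : 'M[int]_(m, n)) : rel 'I_(n + m) :=
  fun u v =>
    match split u, split v with
    | inl j, inl i => (j < i)%N
    | inl j, inr p => M p j == 1
    | inr p, inl j => M p j == -1
    | inr _, inr _ => false
    end.

Section Morphism.
Variables (m n : nat) (A B C : 'M[int]_(m, n)).

(* Only used at -1, 0, 1. *)
Definition block (x : int) : 'M[int]_(m, n) :=
  if x == 0 then A else if x == 1 then B else C.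

(* [mxtens_unindex] sends the row index i of the result to the pair
   (i %/ m, i %% m): the row of blocks, and the row inside the block. *)
Definition morphism_mx (p q : nat) (M : 'M[int]_(p, q)) :
    'M[int]_(p * m, q * n) :=
  \matrix_(i, j)
    block (M (mxtens_unindex i).1 (mxtens_unindex j).1)
          (mxtens_unindex i).2 (mxtens_unindex j).2.

Fixpoint Mk (k : nat) : 'M[int]_(m ^ k, n ^ k) :=
  match k with
  | 0%N => 0
  | k'.+1 => castmx (esym (expnSr m k'), esym (expnSr n k'))
                    (morphism_mx (Mk k'))
  end.

Definition Gok (k : nat) : rel 'I_(n ^ k + m ^ k) := Go (Mk k).

(* [None] stands for infinity. *)
Definition IST : option nat :=
  if pselect (exists l, ~~ `[< semi_transitive (@Gok l) >]) is left ex
  then Some (ex_minn ex) else None.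

End Morphism.

Definition independent_from_B (m n : nat) (A B C : 'M[int]_(m, n)) : Prop :=
  (forall i j, A i j <> 1) /\ (forall i j, C i j <> 1).

Definition independent_from_C (m n : nat) (A B C : 'M[int]_(m, n)) : Prop :=
  (forall i j, A i j <> -1) /\ (forall i j, B i j <> -1).

Definition layered (m n : nat) (M : 'M[int]_(m, n)) : Prop :=
  forall i j j', M i j = M i j'.

Definition row_string (m n : nat) (M : 'M[int]_(m, n)) (i : 'I_m) : seq int :=
  [seq M i j | j <- enum 'I_n].

Definition leftmost_exempt_row (n : nat) (s : seq int) : Prop :=
  s = 0 :: nseq n.-1 (-1) \/ s = 1 :: nseq n.-1 (-1).

Definition all_but_leftmost_negative (m n : nat) (A B C : 'M[int]_(m, n)) :
    Prop :=
  [/\ forall i, leftmost_exempt_row n (row_string A i),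
      forall i, leftmost_exempt_row n (row_string B i)
    & C = const_mx (-1)].

(* Main.v *)
(* If every row of a matrix is [0] or [1] followed by [-1]'s, its graph is
   transitively closed, and the morphism of an all-but-leftmost-negative triple
   preserves this shape of rows.

   Conversely, assume that all graphs are semi-transitive. No row of any
   [Mk k] contains one of [-1 ... 1], [1 ... 0 ... 1] or [-1 ... 0 ... -1] as a
   scattered subword. The hypotheses make all three letters occur. If [x ... x]
   occurs, then so does the image of [xx], which contains some [u v u] and
   [v u v] with [u <> v] whenever the block of [x] is not layered; hence two
   equal letters of {0, 1} never occur in one row, which forces [C = -1].
   Applying the morphism once more excludes [-1 ... 0], [0 ... 1] and
   [1 ... 0] too, so rows of [A] and [B] are [-1] after their first entry.
   Finally a row [-1 -1 ...] in [A] or [B] would coexist with a row [1 -1 ...]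
   in some [Mk k], giving a shortcut through the first two columns. *)
Require Import Defs.
From mathcomp Require Import all_boot all_order all_algebra.
From mathcomp Require Import boolp mxtens.

Set Implicit Arguments.
Unset Strict Implicit.
Unset Printing Implicit Defensive.

Local Open Scope ring_scope.

(** * Semi-transitivity in arbitrary directed graphs *)

Lemma transitive_semi_transitive (T : finType) (e : rel T) :
  irreflexive e -> transitive e -> semi_transitive e.
Proof.
move=> irr tr; split=> [[|x c] // /andP[] /= cyc _|u p _ pth].
  have: path e x (rcons c x) by [].
  rewrite (path_pairwise tr) /= => /andP[/allP/(_ x)].
  by rewrite mem_rcons inE eqxx irr => /(_ isT).
by right; rewrite -(path_pairwise tr).
Qed.

Lemma semi_transitive_path4 (T : finType) (e : rel T) (u v w x : T) :
  semi_transitive e -> e u v -> e v w -> e w x -> e u x -> e u w && e v x.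
Proof.
move=> [_ st] uv vw wx ux.
case: (st u [:: v; w; x]) => //=; rewrite ?uv ?vw ?wx ?ux //.
by rewrite !andbT.
Qed.

(** * Patterns excluded from the rows of a single matrix *)

Section GoEdges.
Variables (m n : nat) (M : 'M[int]_(m, n)).
Implicit Types (p q : 'I_m) (i j k l : 'I_n).

Let splitL j : split (lshift m j) = inl j := unsplitK (inl j).
Let splitR p : split (rshift n p) = inr p := unsplitK (inr p).

Lemma Go_cc j i : Go M (lshift m j) (lshift m i) = (j < i)%N.
Proof. by rewrite /Go !splitL. Qed.

Lemma Go_cr j p : Go M (lshift m j) (rshift n p) = (M p j == 1).
Proof. by rewrite /Go splitL splitR. Qed.

Lemma Go_rc p j : Go M (rshift n p) (lshift m j) = (M p j == -1).
Proof. by rewrite /Go splitL splitR. Qed.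

Lemma Go_rr p q : Go M (rshift n p) (rshift n q) = false.
Proof. by rewrite /Go !splitR. Qed.

Definition GoE := (Go_cc, Go_cr, Go_rc, Go_rr).

Hypothesis st : semi_transitive (Go M).

(** The vertices would form the cycle p -> j -> k -> p. *)
Lemma no_neg_pos p j k : (j < k)%N -> M p j = -1 -> M p k = 1 -> False.
Proof.
move=> jk pj pk; case: st => /(_ [:: rshift n p; lshift m j; lshift m k]) ac _.
suff /ac: ucycle (Go M) [:: rshift n p; lshift m j; lshift m k] by [].
rewrite /ucycle /= !GoE jk pj pk !eqxx /= !inE.
by rewrite eq_lshift !eq_rlshift -val_eqE /= neq_ltn jk.
Qed.

(** The path j -> k -> l -> p has the edge j -> p but not k -> p. *)
Lemma no_pos_zero_pos p j k l : (j < k)%N -> (k < l)%N ->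
  M p j = 1 -> M p k = 0 -> M p l = 1 -> False.
Proof.
move=> jk kl pj pk pl.
have := @semi_transitive_path4 _ _ (lshift m j) (lshift m k) (lshift m l)
  (rshift n p) st.
by rewrite !GoE jk kl pj pk pl eqxx andbF => /(_ isT isT isT isT).
Qed.

(** The path p -> j -> k -> l has the edge p -> l but not p -> k. *)
Lemma no_neg_zero_neg p j k l : (j < k)%N -> (k < l)%N ->
  M p j = -1 -> M p k = 0 -> M p l = -1 -> False.
Proof.
move=> jk kl pj pk pl.
have := @semi_transitive_path4 _ _ (rshift n p) (lshift m j) (lshift m k)
  (lshift m l) st.
by rewrite !GoE jk kl pj pk pl eqxx /= => /(_ isT isT isT isT).
Qed.

(* The path q -> j -> p -> k has the edge q -> k but not q -> p. *)
Lemma no_neg_neg_over_pos_neg p q j k : (j < k)%N ->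
  M p j = 1 -> M p k = -1 -> M q j = -1 -> M q k = -1 -> False.
Proof.
move=> jk pj pk qj qk.
have := @semi_transitive_path4 _ _ (rshift n q) (lshift m j) (rshift n p)
  (lshift m k) st.
by rewrite !GoE pj pk qj qk !eqxx /= => /(_ isT isT isT isT).
Qed.

End GoEdges.

(** For two distinct letters, one of the two alternating words of length three is excluded: -1 0 -1,
    or 1 0 1, or a word containing -1 ... 1. *)
Lemma no_alternation (m n : nat) (M : 'M[int]_(m, n)) (tM : ternary_mx M)
    (st : semi_transitive (Go M)) (p q : 'I_m) (j k l j' k' l' : 'I_n) :
  (j < k)%N -> (k < l)%N -> (j' < k')%N -> (k' < l')%N ->
  M p l = M p j -> M q l' = M q j' ->
  M q j' = M p k -> M q k' = M p j ->
  M p j = M p k.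
Proof.
move=> jk kl jk' kl' pl ql' qj' qk'.
have := tM p j; have := tM p k; rewrite !inE.
case/or3P=> /eqP b; case/or3P=> /eqP a; rewrite a b // in qj' qk' pl *;
  rewrite qj' in ql'; exfalso.
- exact: (no_neg_zero_neg st jk' kl' qj' qk' ql').
- exact: (no_neg_pos st kl b pl).
- exact: (no_neg_zero_neg st jk kl a b pl).
- exact: (no_pos_zero_pos st jk kl a b pl).
- exact: (no_neg_pos st jk a b).
- exact: (no_pos_zero_pos st jk' kl' qj' qk' ql').
Qed.

(** * Block coordinates, and letters occurring at some level *)

Section Cells.
Variables (m n : nat) (A B C : 'M[int]_(m, n)).
Local Notation Mk := (Mk A B C).
Local Notation block := (block A B C).

Definition mk_row k (p : 'I_(m ^ k)) (r : 'I_m) : 'I_(m ^ k.+1) :=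
  cast_ord (esym (expnSr m k)) (mxtens_index (p, r)).

Definition mk_col k (j : 'I_(n ^ k)) (s : 'I_n) : 'I_(n ^ k.+1) :=
  cast_ord (esym (expnSr n k)) (mxtens_index (j, s)).

Lemma Mk_cell k (p : 'I_(m ^ k)) (j : 'I_(n ^ k)) r s :
  Mk k.+1 (mk_row p r) (mk_col j s) = block (Mk k p j) r s.
Proof. by rewrite /= castmxE /= /morphism_mx mxE !cast_ordK !mxtens_indexK. Qed.

Lemma mk_rowP k (P : 'I_(m ^ k.+1) -> Prop) :
  (forall p r, P (mk_row p r)) -> forall p, P p.
Proof.
move=> H p; have := H (mxtens_unindex (cast_ord (expnSr m k) p)).1
  (mxtens_unindex (cast_ord (expnSr m k) p)).2.
by rewrite /mk_row -surjective_pairing mxtens_unindexK cast_ordK.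
Qed.

Lemma mk_colP k (P : 'I_(n ^ k.+1) -> Prop) :
  (forall j s, P (mk_col j s)) -> forall j, P j.
Proof.
move=> H p; have := H (mxtens_unindex (cast_ord (expnSr n k) p)).1
  (mxtens_unindex (cast_ord (expnSr n k) p)).2.
by rewrite /mk_col -surjective_pairing mxtens_unindexK cast_ordK.
Qed.

Lemma mk_col_eq0 k (j : 'I_(n ^ k)) (s : 'I_n) :
  (mk_col j s == 0 :> nat) = (j == 0 :> nat) && (s == 0 :> nat).
Proof.
have n0 : (0 < n)%N by case: s => ? /(leq_ltn_trans (leq0n _)).
by rewrite /= addn_eq0 muln_eq0 [X in _ || X]eqn0Ngt n0 orbF.
Qed.

Lemma mk_col_ltl k (j j' : 'I_(n ^ k)) s s' :
  (j < j')%N -> (mk_col j s < mk_col j' s')%N.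
Proof.
(* The middle term is the first column of the block after [j]. *)
move=> jj /=; apply: (@leq_trans (j.+1 * n)).
  by rewrite mulSn addnC ltn_add2r.
by rewrite (leq_trans _ (leq_addr _ _)) // leq_mul2r jj orbT.
Qed.

Lemma mk_col_ltr k (j : 'I_(n ^ k)) (s s' : 'I_n) :
  (s < s')%N -> (mk_col j s < mk_col j s')%N.
Proof. by rewrite /= ltn_add2l. Qed.

Lemma Mk_ternary k :
  ternary_mx A -> ternary_mx B -> ternary_mx C -> ternary_mx (Mk k).
Proof.
move=> tA tB tC; case: k => [|k]; first by move=> i j; rewrite mxE.
apply: mk_rowP => p r; apply: mk_colP => j s.
by rewrite Mk_cell /Defs.block; case: ifP => // _; case: ifP.
Qed.

Lemma IST_None :
  IST A B C = None <-> forall k, semi_transitive (@Gok m n A B C k).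
Proof.
rewrite /IST; case: pselect => [ex|nex]; split=> // st.
- by case: ex => l /asboolPn[].
- by move=> k; apply: contrapT => nst; apply: nex; exists k; apply/asboolPn.
Qed.

Definition occurs (x : int) := exists k p j, Mk k p j = x.

(** Scattered two-letter subwords of a row; the level is forgotten so that the morphism can be
    applied repeatedly without tracking it. *)
Definition occurs2 (x y : int) :=
  exists k p (j j' : 'I_(n ^ k)), [/\ (j < j')%N, Mk k p j = x & Mk k p j' = y].

Lemma occurs0 : occurs 0.
Proof. by exists 0%N, ord0, ord0; rewrite mxE. Qed.

Lemma occurs_block x r s : occurs x -> occurs (block x r s).
Proof.
move=> [k [p [j <-]]].
by exists k.+1, (mk_row p r), (mk_col j s); rewrite Mk_cell.
Qed.

Lemma occurs2_in_block x r (s t : 'I_n) :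
  occurs x -> (s < t)%N -> occurs2 (block x r s) (block x r t).
Proof.
move=> [k [p [j <-]]] st.
exists k.+1, (mk_row p r), (mk_col j s), (mk_col j t).
by rewrite !Mk_cell mk_col_ltr.
Qed.

Lemma occurs2_blocks x y r s t :
  occurs2 x y -> occurs2 (block x r s) (block y r t).
Proof.
move=> [k [p [j [j' [jj <- <-]]]]].
exists k.+1, (mk_row p r), (mk_col j s), (mk_col j' t).
by rewrite !Mk_cell mk_col_ltl.
Qed.

End Cells.

(** * Pairs of letters that cannot share a row *)

Section ForbiddenPairs.
Variables (m n : nat) (A B C : 'M[int]_(m, n)).
Hypotheses (tA : ternary_mx A) (tB : ternary_mx B) (tC : ternary_mx C).
Hypothesis st : forall k, semi_transitive (@Gok m n A B C k).
Local Notation Mk := (Mk A B C).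
Local Notation block := (block A B C).
Local Notation occurs := (occurs A B C).
Local Notation occurs2 := (occurs2 A B C).

Lemma occurs2_neg_pos : ~ occurs2 (-1) 1.
Proof. by move=> [k [p [j [j' [jj a b]]]]]; apply: (no_neg_pos (st k) jj a b). Qed.

Lemma occurs2_same x : occurs2 x x -> layered (block x).
Proof.
move=> [k [p [j [j' [jj a b]]]]].
suff lt r (s t : 'I_n) : (s < t)%N -> block x r s = block x r t.
  move=> r s t; case: (ltngtP s t) => [/lt|/lt->|/val_inj->] //; exact.
(* With u, v the entries at s < t, the two copies of row [r] give u v ... u v, which contains both u
   v u and v u v. *)
move=> s_t; have := @no_alternation _ _ _
  (@Mk_ternary _ _ _ _ _ k.+1 tA tB tC) (st k.+1)
  (mk_row p r) (mk_row p r) (mk_col j s) (mk_col j t) (mk_col j' s)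
  (mk_col j t) (mk_col j' s) (mk_col j' t).
by rewrite !Mk_cell a b; apply=> //; (exact: mk_col_ltl || exact: mk_col_ltr).
Qed.

End ForbiddenPairs.

(** * Necessity, with at least two columns *)

Section Necessity.
Variables (m n : nat) (A B C : 'M[int]_(m, n.+2)).
Hypotheses (tA : ternary_mx A) (tB : ternary_mx B) (tC : ternary_mx C).
Hypothesis A0 : exists i j, A i j = 0.
Hypothesis notindB : ~ independent_from_B A B C.
Hypothesis notindC : ~ independent_from_C A B C.
Hypotheses (nlayA : ~ layered A) (nlayB : ~ layered B) (layC : layered C).
Hypothesis st : forall k, semi_transitive (@Gok m n.+2 A B C k).
Local Notation block := (block A B C).
Local Notation occurs := (occurs A B C).
Local Notation occurs2 := (occurs2 A B C).

Let occA r s : occurs (A r s) := occurs_block r s (occurs0 A B C).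

(** A -1 in [A] occurs at once. A -1 in [B] occurs as soon as 1 does, and a nonlayered [A] without
    -1 must contain 1. *)
Lemma occursN1 : occurs (-1).
Proof.
apply: contrapT => no; apply: notindC; split=> i j e.
  by apply: no; rewrite -e.
have no1 : ~ occurs 1 by move/(occurs_block i j); rewrite /= /Defs.block /= e.
apply: nlayA; suff z r s : A r s = 0 by move=> r s t; rewrite !z.
have := tA r s; have := @occA r s; rewrite !inE.
by move=> o /or3P[] /eqP e' //; rewrite e' in o.
Qed.

(** A 1 in [A] is reached from 0, a 1 in [C] from the letter -1 just obtained. *)
Lemma occurs1 : occurs 1.
Proof.
apply: contrapT => no; apply: notindB; split=> i j e; apply: no; rewrite -e //.
exact: (occurs_block i j occursN1).
Qed.

Let no00 : ~ occurs2 0 0 := fun o => nlayA (occurs2_same tA tB tC st o).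
Let no11 : ~ occurs2 1 1 := fun o => nlayB (occurs2_same tA tB tC st o).

(** Since -1 occurs, so does every row of [C]; such a row is constant of length at least two, so its
    letter is neither 0 nor 1. *)
Lemma C_negative i j : C i j = -1.
Proof.
have := @occurs2_in_block _ _ A B C (-1) i ord0 ord_max occursN1 isT.
rewrite /Defs.block /= -!(layC i j) => o.
by have := tC i j; rewrite !inE => /or3P[] /eqP e //; rewrite e in o;
  [case: (no00 o)|case: (no11 o)].
Qed.

Lemma one_in_A : exists i j, A i j = 1.
Proof.
apply: contrapT => no; apply: notindB; split=> i j; last by rewrite C_negative.
by move=> e; apply: no; exists i, j.
Qed.

(** In the image, a -1 of [C] would precede a 1 of [A]. *)
Let noN0 : ~ occurs2 (-1) 0.
Proof.
have [i [j e]] := one_in_A; move/(occurs2_blocks i j j).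
by rewrite /Defs.block /= C_negative e; exact: (occurs2_neg_pos st).
Qed.

(* The entry [block y r t] is 0 or 1 and follows all of row [r] of [block x],
   which is therefore constant equal to the other of these two letters. *)
Lemma no_distinct_nonneg x y r t : ternary_mx (block x) ->
  block y r t != -1 -> ternary_mx (block y) -> ~ occurs2 x y.
Proof.
move=> tx nN ty o.
have := @occurs2_blocks _ _ A B C x y r _ t o => o'.
suff [z [z01 zE]] : exists z, (z = 0 \/ z = 1) /\ forall s, block x r s = z.
  have [k [p [j [j' [jj a b]]]]] := o.
  have := @occurs2_in_block _ _ A B C x r ord0 ord_max
    (ex_intro _ k (ex_intro _ p (ex_intro _ j a))) isT.
  by rewrite !zE; case: z01 => ->; [apply: no00|apply: no11].
have noN1 := occurs2_neg_pos st.
have := ty r t; rewrite !inE (negbTE nN) /= => /orP[] /eqP e; rewrite e in o'.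
  exists 1; split; first by right.
  move=> s; have := tx r s; have := o' s; rewrite !inE.
  by move=> os /or3P[] /eqP es //; rewrite es in os; [case: noN0|case: no00].
exists 0; split; first by left.
move=> s; have := tx r s; have := o' s; rewrite !inE.
by move=> os /or3P[] /eqP es //; rewrite es in os; [case: noN1|case: no11].
Qed.

Lemma nonlayered_nonneg (M : 'M[int]_(m, n.+2)) :
  ~ layered M -> exists i j, M i j != -1.
Proof.
move=> nl; apply: contrapT => no; apply: nl => i j j'.
suff z k : M i k = -1 by rewrite !z.
by apply/eqP; apply: contraT => e; case: no; exists i, k.
Qed.

Lemma occurs2_neg x y : x \in [:: -1; 0; 1] -> y \in [:: -1; 0; 1] ->
  occurs2 x y -> y = -1.
Proof.
have [iA [jA eA]] := nonlayered_nonneg nlayA.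
have [iB [jB eB]] := nonlayered_nonneg nlayB.
(* The pairs 0 0, 1 1 and -1 0 are closed by [no00], [no11] and [noN0]. *)
rewrite !inE => /or3P[]/eqP-> /or3P[]/eqP-> // o; exfalso.
- exact: (occurs2_neg_pos st o).
- exact: (@no_distinct_nonneg 0 1 iB jB).
- exact: (@no_distinct_nonneg 1 0 iA jA).
Qed.

Lemma A_tail i (j : 'I_n.+2) : (0 < j)%N -> A i j = -1.
Proof.
move=> j0; apply: (@occurs2_neg (A i ord0)) => //.
exact: (@occurs2_in_block _ _ A B C 0 i ord0 j (occurs0 A B C) j0).
Qed.

Lemma B_tail i (j : 'I_n.+2) : (0 < j)%N -> B i j = -1.
Proof.
move=> j0; apply: (@occurs2_neg (B i ord0)) => //.
exact: (@occurs2_in_block _ _ A B C 1 i ord0 j occurs1 j0).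
Qed.

Lemma head_of_entry (M : 'M[int]_(m, n.+2)) i j x :
  (forall k : 'I_n.+2, (0 < k)%N -> M i k = -1) ->
  M i j = x -> x != -1 -> M i ord0 = x.
Proof.
case: (posnP j) => [/eqP j0 _ <- _|j0 tl <-]; last by rewrite tl ?eqxx.
by congr (M i _); apply/esym/eqP.
Qed.

Lemma A_head i : A i ord0 != -1.
Proof.
apply/eqP => e; have [i1 [j1 e1]] := one_in_A.
have h1 := head_of_entry (@A_tail i1) e1 isT.
(* Level 1 is a copy of [A], where row [i1] starts with 1 and row [i] with -1. *)
have := @no_neg_neg_over_pos_neg _ _ _ (st 1)
  (mk_row (ord0 : 'I_(m ^ 0)) i1) (mk_row (ord0 : 'I_(m ^ 0)) i)
  (mk_col (ord0 : 'I_(n.+2 ^ 0)) ord0) (mk_col (ord0 : 'I_(n.+2 ^ 0)) ord_max).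
rewrite mk_col_ltr // !Mk_cell (_ : Mk A B C 0 ord0 ord0 = 0) ?mxE //.
by rewrite /Defs.block /= h1 e !A_tail //; exact.
Qed.

Lemma B_head i : B i ord0 != -1.
Proof.
apply/eqP => e; have [i1 [j1 e1]] := one_in_A; have [i0 [j0 e0]] := A0.
have h1 := head_of_entry (@A_tail i1) e1 isT.
have h0 := head_of_entry (@A_tail i0) e0 isT.
pose r0 := mk_row (ord0 : 'I_(m ^ 0)).
pose c := mk_col (ord0 : 'I_(n.+2 ^ 0)) ord0.
(* At level 2 the first block column holds [A] in block row [i0] and [B] in block row [i1]; row [i1]
   of the former meets row [i] of the latter. *)
have := @no_neg_neg_over_pos_neg _ _ _ (st 2)
  (mk_row (r0 i0) i1) (mk_row (r0 i1) i) (mk_col c ord0) (mk_col c ord_max).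
rewrite mk_col_ltr // !Mk_cell (_ : Mk A B C 0 ord0 ord0 = 0) ?mxE //.
by rewrite /Defs.block /= h0 h1 /= e A_tail // B_tail //; exact.
Qed.

Lemma leftmost_exempt_rowI (M : 'M[int]_(m, n.+2)) i : ternary_mx M ->
  M i ord0 != -1 -> (forall j : 'I_n.+2, (0 < j)%N -> M i j = -1) ->
  leftmost_exempt_row n.+2 (row_string M i).
Proof.
move=> tM h tl.
have -> : row_string M i = M i ord0 :: nseq n.+1 (-1).
  rewrite /row_string enum_ordSl /= -map_comp; congr (_ :: _).
  set s := map _ _; have sz_s : size s = n.+1 by rewrite size_map size_enum_ord.
  (* [all_pred1P] needs the length in the form [size s]. *)
  rewrite -[RHS]/(nseq n.+1 (-1)) -sz_s.
  by apply/all_pred1P/allP => _ /mapP[j _ ->]; rewrite /= tl.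
have := tM i ord0; rewrite !inE (negbTE h) /= /leftmost_exempt_row.
by case/orP=> /eqP->; [left|right].
Qed.

Lemma necessity : all_but_leftmost_negative A B C.
Proof.
split=> [i|i|]; last by apply/matrixP => i j; rewrite mxE C_negative.
- by apply: leftmost_exempt_rowI => //; [exact: A_head|exact: A_tail].
- by apply: leftmost_exempt_rowI => //; [exact: B_head|exact: B_tail].
Qed.

End Necessity.

(** * Sufficiency: the shape is preserved and gives transitive graphs *)

Definition leftmost_exempt (m n : nat) (M : 'M[int]_(m, n)) : Prop :=
  forall i (j : 'I_n), M i j \in (if j == 0 :> nat then [:: 0; 1] else [:: -1]).

Lemma leftmost_exempt_rowE (m n : nat) (M : 'M[int]_(m, n)) :
  (forall i, leftmost_exempt_row n (row_string M i)) -> leftmost_exempt M.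
Proof.
move=> H i j.
have <- : nth 0 (row_string M i) j = M i j.
  by rewrite (nth_map j) ?size_enum_ord // nth_ord_enum.
case: j => [[|j] lj] /=; case: (H i) => -> //=; rewrite nth_nseq ifT //.
all: by case: n lj {M H i}.
Qed.

(** Blocks in the first block column replace 0 or 1, so they are [A] or [B]; all others are [C]. *)
Lemma leftmost_exempt_Mk (m n : nat) (A B C : 'M[int]_(m, n)) k :
  leftmost_exempt A -> leftmost_exempt B -> C = const_mx (-1) ->
  leftmost_exempt (Mk A B C k).
Proof.
move=> eA eB eC; elim: k => [|k IH].
  by move=> i j; rewrite mxE; case: j => [[|j] lj].
apply: mk_rowP => p r; apply: mk_colP => j s.
rewrite Mk_cell mk_col_eq0; have := IH p j; case: ifP => _ /=.
  by rewrite !inE => /orP[]/eqP-> ; [exact: eA|exact: eB].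
by rewrite inE => /eqP->; rewrite /block /= eC mxE.
Qed.

(** A row vertex points to every column but the first and can be entered only from the first, so
    every two-step path has its shortcut. *)
Lemma leftmost_exempt_semi_transitive (m n : nat) (M : 'M[int]_(m, n)) :
  leftmost_exempt M -> semi_transitive (Go M).
Proof.
move=> eM.
have pos p (j : 'I_n) : M p j == 1 -> val j = 0%N.
  by have := eM p j; case: eqP => // _; rewrite inE => /eqP->.
have neg p (j : 'I_n) : (M p j == -1) = (0 < j)%N.
  rewrite lt0n; have := eM p j; case: eqP => _; rewrite !inE.
    by case/orP=> /eqP->.
  by move/eqP->.
apply: transitive_semi_transitive => [x|y x z].
  by rewrite -(splitK x); case: (split x) => j /=; rewrite !GoE ?ltnn.
rewrite -(splitK x) -(splitK y) -(splitK z).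
case: (split x) => a; case: (split y) => b; case: (split z) => c /=;
  rewrite !GoE ?neg //.
- exact: ltn_trans.
- by move=> ab /pos b0; rewrite b0 in ab.
- by move=> /pos ->.
- exact: ltn_trans.
- by move=> b0 /pos e; rewrite e in b0.
Qed.

Theorem theorem3p16 (m n : nat) (A B C : 'M[int]_(m, n))
    (tA : ternary_mx A) (tB : ternary_mx B) (tC : ternary_mx C)
    (A0 : exists i j, A i j = 0)
    (notindB : ~ independent_from_B A B C)
    (notindC : ~ independent_from_C A B C)
    (nlayA : ~ layered A) (nlayB : ~ layered B) (layC : layered C) :
  IST A B C = None <-> all_but_leftmost_negative A B C.
Proof.
rewrite IST_None; split=> [st|[rA rB eC] k].
  (* Without columns [A] has no entry, and with a single one it is layered. *)
  case: n => [|[|n]] in A B C tA tB tC A0 notindB notindC nlayA nlayB layC st *.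
  - by case: A0 => i [[]].
  - by case: nlayA => i j j'; rewrite !ord1.
  - exact: necessity.
by apply/leftmost_exempt_semi_transitive/leftmost_exempt_Mk => //;
  apply: leftmost_exempt_rowE.
Qed.
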